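(* Let $X$ be an Archimedean pre-Riesz space and $I\subseteq X$ a directed ideal. (i) Let, in addition, $X$ have the Riesz decomposition property. If $I$ is o-closed, then $I$ is s-closed. (ii) Let, in addition, $X$ be pervasive and the band $I^{dd}$ be directed. If $I$ is s-closed, then $I$ is o-closed.
   Context: An ordered vector space is a real vector space $X$ with the partial order given by a cone $X_+$ ($x\le y$ iff $y-x\in X_+$); it is Archimedean if $nx\le y$ for all $n\in\mathbb{N}$ implies $x\le 0$. Put $[a,b]:=\{x\in X: a\le x\le b\}$. A subset $A\subseteq X$ is directed if for all $x,y\in A$ there are $z_1,z_2\in A$ with $z_1\le x,y\le z_2$. $X$ has the Riesz decomposition property (RDP) if for all $x_1,x_2,z\in X_+$ with $z\le x_1+x_2$ there are $z_1,z_2\in X_+$ with $z=z_1+z_2$, $z_1\le x_1$, $z_2\le x_2$. A linear subspace $X_0$ of an ordered vector space $Y$ is order dense in $Y$ if $y=\inf\{z\in X_0: y\le z\}$ for every $y\in Y$. $X$ is a pre-Riesz space if there are a vector lattice $Y$ and a bipositive linear map $i:X\to Y$ (i.e. $x\ge0 \Leftrightarrow i(x)\ge 0$) with $i(X)$ order dense in $Y$; then $(Y,i)$ is called a vector lattice cover of $X$. $X$ is pervasive if for some (equivalently, every) vector lattice cover $(Y,i)$ and every $y\in Y_+$, $y\ne0$, there is $x\in X$ with $0<i(x)\le y$. For $M\subseteq X$ let $M^u$ be the set of all upper bounds of $M$ in $X$. Elements $x,y\in X$ are disjoint, $x\perp y$, if $\{x+y,-x-y\}^u=\{x-y,-x+y\}^u$.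 The disjoint complement of $A\subseteq X$ is $A^{d}:=\{x\in X: x\perp a \text{ for all } a\in A\}$ and $A^{dd}:=(A^d)^d$. A linear subspace $B$ is a band if $B^{dd}=B$ (disjoint complements are always bands). A set $M\subseteq X$ is solid if for all $x\in X$, $y\in M$, $\{x,-x\}^u\supseteq\{y,-y\}^u$ implies $x\in M$; an ideal is a solid linear subspace. An ideal $I$ is s-closed (supremum closed) if for every $z\in X_+$ the relation $z=\sup(I\cap[0,z])$ (meaning that the supremum exists in $X$ and equals $z$) implies $z\in I$. A net $(x_\alpha)_\alpha$ in $X$ order converges to $x\in X$ if there is a net $(z_\alpha)_\alpha$ in $X$ (same index set) with $z_\alpha\downarrow 0$ (i.e. decreasing with infimum $0$ in $X$) and $\pm(x-x_\alpha)\le z_\alpha$ for all $\alpha$. A set $M\subseteq X$ is o-closed (order closed) if for every net in $M$ that order converges to some $x\in X$ one has $x\in M$. *)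

(* Defs.v *)
From HB Require Import structures.
From mathcomp Require Import all_boot all_order all_algebra.
From mathcomp Require Import classical_sets reals.

Set Implicit Arguments.
Unset Strict Implicit.
Unset Printing Implicit Defensive.

Import Order.TTheory GRing.Theory Num.Theory.
Local Open Scope classical_set_scope.
Local Open Scope ring_scope.

(* The positive cone is [set x | 0 <= x]; antisymmetry of <= says that it is
   pointed. *)
HB.mixin Record Lmodule_isOrderedVector (R : realType) X
    of Num.POrderedZmodule X & GRing.Lmodule R X := {
  lev_wD2r : forall z x y : X, x <= y -> x + z <= y + z;
  scalev_ge0 : forall (a : R) (x : X), 0 <= a -> 0 <= x -> 0 <= a *: x
}.

#[short(type="orderedVectorType")]
HB.structure Definition OrderedVector (R : realType) :=
  { X of Num.POrderedZmodule X & GRing.Lmodule R X &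
         Lmodule_isOrderedVector R X }.

Section OrderedVectorSpaces.
Context {R : realType}.
Implicit Type X : orderedVectorType R.

Definition archimedean_ovs X : Prop :=
  forall x y : X, (forall n : nat, x *+ n <= y) -> x <= 0.

Definition directed X (A : set X) : Prop :=
  forall x y, A x -> A y ->
    exists z1 z2, [/\ A z1, A z2, z1 <= x /\ z1 <= y & x <= z2 /\ y <= z2].

Definition riesz_decomposition X : Prop :=
  forall x1 x2 z : X, 0 <= x1 -> 0 <= x2 -> 0 <= z -> z <= x1 + x2 ->
    exists z1 z2 : X,
      [/\ 0 <= z1, 0 <= z2, z = z1 + z2, z1 <= x1 & z2 <= x2].

Definition linear_subspace X (A : set X) : Prop := submod_closed [in A].

(* [infimums A] is the set of all greatest lower bounds of [A], so
   [infimums A y] says that the infimum of [A] exists and equals [y];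
   likewise for [supremums]. *)
Definition vector_lattice X : Prop :=
  forall x y : X, (exists s, supremums [set x; y] s) /\
                  (exists t, infimums [set x; y] t).

Definition order_dense X (X0 : set X) : Prop :=
  linear_subspace X0 /\
  forall y, infimums [set z | X0 z /\ y <= z] y.

Definition bipositive X (Y : orderedVectorType R) (i : X -> Y) : Prop :=
  forall x, 0 <= x <-> 0 <= i x.

Definition vector_lattice_cover X (Y : orderedVectorType R)
    (i : {linear X -> Y}) : Prop :=
  [/\ vector_lattice Y, bipositive i & order_dense (range i)].

Definition pre_riesz X : Prop :=
  exists (Y : orderedVectorType R) (i : {linear X -> Y}),
    vector_lattice_cover i.

Definition pervasive X : Prop :=
  exists (Y : orderedVectorType R) (i : {linear X -> Y}),
    vector_lattice_cover i /\
    forall y : Y, 0 <= y -> y != 0 -> exists x : X, 0 < i x /\ i x <= y.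

Definition disjointv X (x y : X) : Prop :=
  ubound [set x + y; - x - y] = ubound [set x - y; - x + y].

Definition disjoint_compl X (A : set X) : set X :=
  [set x | forall a, A a -> disjointv x a].

Definition solid X (M : set X) : Prop :=
  forall x y, M y -> ubound [set y; - y] `<=` ubound [set x; - x] -> M x.

Definition ideal X (I : set X) : Prop := solid I /\ linear_subspace I.

Definition s_closed X (I : set X) : Prop :=
  forall z : X, 0 <= z -> supremums (I `&` [set x | 0 <= x <= z]) z -> I z.

Definition directed_index (A : Type) (le : A -> A -> Prop) : Prop :=
  [/\ inhabited A,
      forall a, le a a,
      forall a b c, le a b -> le b c -> le a c
    & forall a b, exists c, le a c /\ le b c].

Definition decreases_to0 X (A : Type) (le : A -> A -> Prop) (z : A -> X) :
    Prop :=
  (forall a b, le a b -> z b <= z a) /\ infimums (range z) 0.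

Definition order_converges X (A : Type) (le : A -> A -> Prop) (u : A -> X)
    (x : X) : Prop :=
  exists z : A -> X, decreases_to0 le z /\
    forall a, x - u a <= z a /\ - (x - u a) <= z a.

Definition o_closed X (M : set X) : Prop :=
  forall (A : Type) (le : A -> A -> Prop) (u : A -> X) (x : X),
    directed_index le -> (forall a, M (u a)) -> order_converges le u x -> M x.

End OrderedVectorSpaces.

Arguments archimedean_ovs {R} X.
Arguments riesz_decomposition {R} X.
Arguments pre_riesz {R} X.
Arguments pervasive {R} X.

(* Main.v *)
(** (i) The decomposition property interpolates between two elements of
    [I `&` [0, z]] and the upper bounds [z] and [w], [w] in [I]; so that set is
    upward directed and, when its supremum is [z], it is itself a net in [I]
    which order converges to [z].

    (ii) Disjointness in [X] is disjointness in the cover [Y], where it says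
    [inf(|p|, |q|) <= 0].  Hence [I^dd] is order closed and the limit of a net in
    [I] is a difference of positive elements of [I^dd].  Each such element [z]
    is the supremum of [I `&` [0, z]]: were [w] an upper bound with
    [(z - w)^+ != 0], pervasiveness (used twice) would give [0 < v] in [I] with
    [v <= (z - w)^+]; then [u + v] is in [I `&` [0, z]] whenever [u] is, so
    [n v <= z] for all [n], against the Archimedean property. *)
Require Import Defs.
From mathcomp Require Import all_boot all_order all_algebra.
From mathcomp Require Import boolp classical_sets reals.

Set Implicit Arguments.
Unset Strict Implicit.
Unset Printing Implicit Defensive.

Import Order.TTheory GRing.Theory Num.Theory.
Local Open Scope classical_set_scope.
Local Open Scope ring_scope.

(** * Order arithmetic, disjointness and solid subspaces; the implication (i) *)

Section OrderedVector.
Context {R : realType} {X : orderedVectorType R}.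
Implicit Types (x y z t u v w a b : X) (A M : set X).

Lemma lev_D2r z x y : (x + z <= y + z) = (x <= y).
Proof.
apply/idP/idP => [/(lev_wD2r (- z))|/lev_wD2r//].
by rewrite !addrK.
Qed.

Lemma lev_D2l z x y : (z + x <= z + y) = (x <= y).
Proof. by rewrite ![z + _]addrC lev_D2r. Qed.

Lemma lev_subLR x y z : (x - y <= z) = (x <= z + y).
Proof. by rewrite -[RHS](lev_D2r (- y)) addrK. Qed.

Lemma lev_subRL x y z : (x <= y - z) = (x + z <= y).
Proof. by rewrite -[LHS](lev_D2r z) subrK. Qed.

Lemma levD x y z t : x <= y -> z <= t -> x + z <= y + t.
Proof.
by move=> xy zt; apply: (@le_trans _ _ (y + z)); rewrite ?lev_D2r ?lev_D2l.
Qed.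

Lemma subv_ge0 x y : (0 <= y - x) = (x <= y).
Proof. by rewrite lev_subRL add0r. Qed.

Lemma lev_N2 x y : (- x <= - y) = (y <= x).
Proof. by rewrite -[LHS](lev_D2l x) subrr subv_ge0. Qed.

Lemma scalev_half x : 2^-1 *: x + 2^-1 *: x = x.
Proof.
rewrite -scalerDl -[2^-1 + 2^-1]mulr2n -[_ *+ 2]mulr_natr mulVf ?scale1r//.
by rewrite pnatr_eq0.
Qed.

Lemma lev_half x y : y <= x + x -> 2^-1 *: y <= x.
Proof.
move=> yx; have h : (0 : R) <= 2^-1 by rewrite invr_ge0 ler0n.
rewrite -subv_ge0; suff -> : x - 2^-1 *: y = 2^-1 *: (x + x - y).
  by apply: scalev_ge0; rewrite ?subv_ge0.
by rewrite scalerBr scalerDr scalev_half.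
Qed.

Lemma half_le0 x : 2^-1 *: x <= 0 -> x <= 0.
Proof. by move=> h; rewrite -[x]scalev_half -[0]addr0; apply: levD. Qed.

Lemma double_le0 x : x + x <= 0 -> x <= 0.
Proof. by move=> h; rewrite -[x]scalev_half -scalerDr lev_half// addr0. Qed.

Lemma ubound2 a b u : ubound [set a; b] u <-> a <= u /\ b <= u.
Proof.
split=> [h|[au bu] _ [->|->]//].
by split; apply: h; [left|right].
Qed.

Lemma disjointvP x y : disjointv x y <->
  forall u, (x + y <= u /\ - x - y <= u) <-> (x - y <= u /\ - x + y <= u).
Proof.
split=> [xy u|xy]; first by rewrite -!ubound2 xy.
by apply/seteqP; split=> u /ubound2/xy/ubound2.
Qed.

Lemma disjointv_sym x y : disjointv x y -> disjointv y x.
Proof.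
move=> /disjointvP xy; apply/disjointvP => u.
rewrite [y + x]addrC [- y - x]addrC [y - x]addrC [- y + x]addrC.
by have := xy u; tauto.
Qed.

Lemma sub_bicompl A : A `<=` disjoint_compl (disjoint_compl A).
Proof. by move=> x Ax a aA; apply/disjointv_sym/aA. Qed.

Lemma solid_itv M x y : solid M -> M y -> 0 <= x -> x <= y -> M x.
Proof.
move=> solM My x0 xy; apply: (solM _ y) => // u /ubound2[yu _].
apply/ubound2; have xu := le_trans xy yu; split=> //.
apply: le_trans (le_trans x0 xu).
by rewrite -[leRHS]oppr0 lev_N2.
Qed.

Lemma subspaceB A x y : linear_subspace A -> A x -> A y -> A (x - y).
Proof.
case=> _ h Ax Ay.
by have := h (-1) y x; rewrite !inE scaleN1r addrC; apply.
Qed.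

Lemma subspace0 A : linear_subspace A -> A 0.
Proof. by case; rewrite inE. Qed.

Lemma subspaceD A x y : linear_subspace A -> A x -> A y -> A (x + y).
Proof.
move=> sA Ax Ay; rewrite -[y]opprK -[- y]add0r.
by do 2?apply: (subspaceB sA) => //; apply: subspace0.
Qed.

(** Since [a2 <= b1], [b2 - a1] lies below [(b2 - a2) + (b1 - a1)]. Decomposing it as [p + q]
    accordingly, [c = a1 + q = b2 - p] interpolates. *)
Lemma riesz_interpolation a1 a2 b1 b2 : riesz_decomposition X ->
  a1 <= b1 -> a1 <= b2 -> a2 <= b1 -> a2 <= b2 ->
  exists c, [/\ a1 <= c, a2 <= c, c <= b1 & c <= b2].
Proof.
move=> rdp a11 a12 a21 a22.
have [|||| p [q [p0 q0 e pb qb]]] := rdp (b2 - a2) (b1 - a1) (b2 - a1).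
- by rewrite subv_ge0.
- by rewrite subv_ge0.
- by rewrite subv_ge0.
- by rewrite addrA lev_D2r -addrA -[leLHS]addr0 lev_D2l addrC subv_ge0.
have e' : a1 + q = b2 - p.
  by apply/eqP; rewrite eq_sym subr_eq -addrA [q + p]addrC -e addrC subrK.
exists (a1 + q); split.
- by rewrite -[leLHS]addr0 lev_D2l.
- by rewrite e' lev_subRL addrC -lev_subRL.
- by rewrite addrC -lev_subRL.
- by rewrite e' lev_subLR -[leLHS]addr0 lev_D2l.
Qed.

Lemma o_closed_s_closed (I : set X) : riesz_decomposition X ->
  ideal I -> directed I -> o_closed I -> s_closed I.
Proof.
move=> rdp [solI subI] dirI oI z z0 [_ lubz].
pose A := {x : X | I x /\ 0 <= x <= z}.
apply: (oI A (fun a b : A => sval a <= sval b) sval z) => [|[x []]//|].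
- split.
  + by constructor; exists 0; rewrite lexx z0; split=> //; apply: subspace0.
  + by move=> a; apply: lexx.
  + by move=> a b c; apply: le_trans.
  + case=> a Pa; case=> b Pb; have [[Ia /andP[a0 az]] [Ib /andP[b0 bz]]] := (Pa, Pb).
    have [_ [w [_ Iw _ [aw bw]]]] := dirI _ _ Ia Ib.
    have [c [ac bc cw cz]] := riesz_interpolation rdp aw az bw bz.
    have c0 := le_trans a0 ac.
    have Hc : I c /\ 0 <= c <= z.
      by rewrite c0 cz; split=> //; apply: solid_itv Iw _ _.
    by exists (exist _ c Hc).
(* The error [z - a] is its own dominating net; its infimum is 0 because the supremum of the index
   set is [z]. *)
exists (fun a : A => z - sval a); split; first split.
- by move=> [a Pa] [b Pb] ab; rewrite lev_D2l lev_N2.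
- split=> [_ [[a Pa] _ <-]|l lbl] /=.
    by rewrite subv_ge0; case: Pa => _ /andP[].
  rewrite -(lev_D2l z) addr0 -lev_subRL; apply: lubz => a Ia.
  rewrite lev_subRL addrC -lev_subRL; apply: lbl.
  by exists (exist _ a Ia).
- move=> [a Pa] /=; split=> //.
  have h : 0 <= z - a by rewrite subv_ge0; case: Pa => _ /andP[].
  by apply: (le_trans _ h); rewrite -[leRHS]oppr0 lev_N2.
Qed.

End OrderedVector.

(** * Moduli in a vector lattice and disjointness *)

Section Modulus.
Context {R : realType} {Y : orderedVectorType R}.
Implicit Types (p q r t u y m s : Y).

Definition is_modulus (abs : Y -> Y) : Prop :=
  forall p, [/\ p <= abs p, - p <= abs p &
                forall u, p <= u -> - p <= u -> abs p <= u].

Lemma modulus_exists : vector_lattice Y -> exists abs, is_modulus abs.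
Proof.
move=> latY; suff /choice[abs absP] : forall p, exists s,
    [/\ p <= s, - p <= s & forall u, p <= u -> - p <= u -> s <= u].
  by exists abs.
move=> p; have [[s [/ubound2[ps nps] lub]] _] := latY p (- p).
by exists s; split=> // u pu npu; apply: lub; apply/ubound2.
Qed.

Lemma pospart_exists p : vector_lattice Y ->
  exists s, [/\ p <= s, 0 <= s & forall u, p <= u -> 0 <= u -> s <= u].
Proof.
move=> latY; have [[s [/ubound2[ps nps] lub]] _] := latY p 0.
by exists s; split=> // u pu npu; apply: lub; apply/ubound2.
Qed.

Variables (abs : Y -> Y) (absP : is_modulus abs).

Lemma modulus_ge0 p : 0 <= abs p.
Proof.
have [pa npa _] := absP p; rewrite -lev_N2 oppr0; apply: double_le0.
by rewrite -(subrr p) -[leRHS]addrC levD// -lev_N2 ?opprK.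
Qed.

(** Distributivity of the infimum of [y] with [abs p = sup(p, -p)], stated by lower bounds. For
    [r = p] and [r = - p], the element [r + y - abs p] is below both [r] and [y], hence below [m];
    so [m + abs p - y] bounds [p] and [- p], thus also [abs p]. *)
Lemma modulus_distr p y m :
  (forall t, t <= p -> t <= y -> t <= m) ->
  (forall t, t <= - p -> t <= y -> t <= m) -> y <= abs p -> y <= m.
Proof.
move=> pm npm yp; have [pa npa lub] := absP p.
have key r : (forall t, t <= r -> t <= y -> t <= m) -> r <= abs p ->
    r <= m + abs p - y.
  move=> rm ra; rewrite lev_subRL -lev_subLR; apply: rm.
    by rewrite lev_subLR lev_D2l.
  by rewrite lev_subLR addrC lev_D2l.
have := lub _ (key p pm pa) (key (- p) npm npa).
by rewrite lev_subRL [m + _]addrC lev_D2l.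
Qed.

Lemma disjointv_modulus p q : disjointv p q <->
  forall y, y <= abs p -> y <= abs q -> y <= 0.
Proof.
rewrite disjointvP; split=> [pq y yp yq|pq u].
- have core p' q' t : (forall u, p' - q' <= u -> q' - p' <= u -> p' + q' <= u) ->
      t <= p' -> t <= q' -> t <= 0.
    move=> h tp tq; apply: double_le0.
    (* [inf(2p', 2q') = (p' + q') - |p' - q'|] *)
    suff : p' + q' <= p' + q' - (t + t).
      by rewrite lev_subRL -[leRHS]addr0 lev_D2l.
    apply: h; rewrite lev_subRL.
      by rewrite -addrA lev_D2l -[leRHS](addKr q') lev_D2l levD.
    by rewrite [p' + q']addrC -addrA lev_D2l -[leRHS](addKr p') lev_D2l levD.
  (* Distributivity, once for each modulus, leaves the four choices of signs of [p] and [q]. *)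
  apply: modulus_distr yq => s sq sy; apply: modulus_distr (le_trans sy yp).
  + move=> r rp rs; apply: (core p q r) => //; last exact: le_trans sq.
    by move=> u h1 h2; apply: (proj2 (pq u) _).1; rewrite [- p + q]addrC.
  + move=> r rp rs; apply: (core (- p) q r) => //; last exact: le_trans sq.
    move=> u h1 h2; apply: (proj1 (pq u) _).2; split=> //.
    by rewrite addrC; move: h2; rewrite opprK.
  + move=> r rp rs; apply: (core p (- q) r) => //; last exact: le_trans sq.
    move=> u; rewrite opprK => h1 h2; apply: (proj1 (pq u) _).1; split=> //.
    by rewrite addrC.
  + move=> r rp rs; apply: (core (- p) (- q) r) => //; last exact: le_trans sq.
    move=> u; rewrite !opprK => h1 h2; apply: (proj2 (pq u) _).2.
    by rewrite [p - q]addrC.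
- have core p' q' : p' <= abs p -> q' <= abs q ->
      p' - q' <= u -> q' - p' <= u -> p' + q' <= u.
    (* Half of [p' + q' - u] is below both moduli, because [p' + q'] is [2p' + (q' - p')] and also
       [2q' + (p' - q')]. *)
    move=> hp hq u1 u2; rewrite -[u]add0r -lev_subLR; apply: half_le0.
    apply: pq; apply: lev_half; rewrite lev_subLR.
      have -> : p' + q' = p' + p' + (q' - p').
        by rewrite -addrA [p' + (_ - _)]addrC subrK.
      by rewrite levD// levD.
    have -> : p' + q' = q' + q' + (p' - q').
      by rewrite -addrA [q' + (_ - _)]addrC subrK addrC.
    by rewrite levD// levD.
  have [p1 p2 _] := absP p; have [q1 q2 _] := absP q.
  by split=> -[u1 u2]; split; apply: core; rewrite ?opprK // addrC.
Qed.

End Modulus.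

(** * Transfer to a vector lattice cover; disjoint complements; positive elements of [I^dd] *)

Section Cover.
Context {R : realType} {X Y : orderedVectorType R} (i : {linear X -> Y}).
Hypothesis coverY : vector_lattice_cover i.
Implicit Types (x z w a b u v : X) (y : Y) (A I : set X).

Lemma cover_le x z : (i x <= i z) = (x <= z).
Proof.
have [_ bip _] := coverY.
by rewrite -[LHS]subv_ge0 -[RHS]subv_ge0 -raddfB; apply/idP/idP => /bip.
Qed.

Lemma cover_ge0 x : (0 <= i x) = (0 <= x).
Proof. by rewrite -(raddf0 i) cover_le. Qed.

Lemma cover_le_of_majorants y y' :
  (forall w, y' <= i w -> y <= i w) -> y <= y'.
Proof.
have [_ _ [_ dens]] := coverY; move=> h.
have [_ glb] := dens y'; apply: glb => _ [[w _ <-] y'w].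
exact: h.
Qed.

Lemma cover_le_of_minorants y y' :
  (forall w, i w <= y -> i w <= y') -> y <= y'.
Proof.
move=> h; rewrite -lev_N2; apply: cover_le_of_majorants => w yw.
have := h (- w); rewrite raddfN -{1}(opprK y) lev_N2 => /(_ yw).
by rewrite -{1}[y']opprK lev_N2.
Qed.

(** An infimum 0 in [X] stays an infimum in [Y]: by order density, [y] need only be tested through
    its minorants in the image of [X]. *)
Lemma cover_infimum0 (A : Type) (z : A -> X) y :
  infimums (range z) 0 -> (forall t, y <= i (z t)) -> y <= 0.
Proof.
move=> [_ glb] yz; apply: cover_le_of_minorants => w wy.
rewrite -(raddf0 i) cover_le; apply: glb => _ [t _ <-].
by rewrite -cover_le; apply: le_trans (yz t).
Qed.

(** By order density, upper bounds in [Y] of elements of the image are determined by the upper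
    bounds from [X] lying above them. *)
Lemma disjointv_cover x z : disjointv x z <-> disjointv (i x) (i z).
Proof.
rewrite !disjointvP; split=> xz u; last first.
  by have := xz (i u); rewrite -!(raddfN i) -!(raddfD i) !cover_le.
rewrite -!(raddfN i) -!(raddfD i); split=> -[u1 u2]; split;
  apply: cover_le_of_majorants => w uw; rewrite cover_le;
  move: (le_trans u1 uw) (le_trans u2 uw); rewrite !cover_le => w1 w2;
  by have := xz w; tauto.
Qed.

Variables (abs : Y -> Y) (absP : is_modulus abs).

Lemma disjoint_complP A x : disjoint_compl A x <-> forall a, A a ->
  forall y, y <= abs (i x) -> y <= abs (i a) -> y <= 0.
Proof.
split=> h a Aa; first exact/(disjointv_modulus absP)/disjointv_cover/h.
exact/disjointv_cover/(disjointv_modulus absP)/h.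
Qed.

Lemma modulus_id y : 0 <= y -> abs y = y.
Proof.
move=> y0; have [ya nya lub] := absP y; apply/eqP; rewrite eq_le ya andbT.
by apply: lub => //; apply: (le_trans _ y0); rewrite -[leRHS]oppr0 lev_N2.
Qed.

Lemma disjoint_compl_solid A x z : disjoint_compl A z ->
  0 <= x -> x <= z -> disjoint_compl A x.
Proof.
move=> /disjoint_complP Az x0 xz; apply/disjoint_complP => a Aa y yx ya.
have z0 := le_trans x0 xz.
apply: (Az a) => //; move: yx; rewrite !modulus_id ?cover_ge0//.
by move=> /le_trans; apply; rewrite cover_le.
Qed.

(** If [y] is below [|x - z|] and [|a|], then [y - |x|] is below [|z|] and [|a|]; hence [y <= |x|],
    and then [y <= 0]. *)
Lemma disjoint_compl_sub A x z :
  disjoint_compl A x -> disjoint_compl A z -> disjoint_compl A (x - z).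
Proof.
move=> /disjoint_complP Ax /disjoint_complP Az.
apply/disjoint_complP => a Aa y yxz ya.
have [x1 x2 _] := absP (i x); have [z1 z2 _] := absP (i z).
have xz : abs (i (x - z)) <= abs (i x) + abs (i z).
  by have [_ _] := absP (i (x - z)); apply; rewrite raddfB ?opprD ?opprK levD.
apply: (Ax a) => //; rewrite -[leRHS]add0r -lev_subLR; apply: (Az a) => //.
  by rewrite lev_subLR addrC (le_trans yxz).
by rewrite lev_subLR (le_trans ya)// -[leLHS]addr0 lev_D2l modulus_ge0.
Qed.

(** From [|x| <= |u t| + z t], a common minorant [y] of [|x|] and [|a|] satisfies [y <= z t] for
    every [t]. *)
Lemma disjoint_compl_o_closed A : o_closed (disjoint_compl A).
Proof.
move=> T le u x _ Au [z [[_ inf0] xuz]]; apply/disjoint_complP => a Aa y yx ya.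
apply: (cover_infimum0 inf0) => t.
rewrite -[leRHS]add0r -lev_subLR.
have /disjoint_complP/(_ a Aa) := Au t; apply.
  have [u1 u2 _] := absP (i (u t)); have [h1 h2] := xuz t.
  rewrite lev_subLR (le_trans yx)//.
  have [_ _] := absP (i x); apply.
    by rewrite -[i x](subrK (i (u t))) addrC levD// -raddfB cover_le.
  by rewrite -[i x](subrK (i (u t))) opprD addrC levD// -raddfB -raddfN cover_le.
rewrite lev_subLR (le_trans ya)// -[leLHS]addr0 lev_D2l cover_ge0.
by case: inf0 => lb _; apply: lb; exists t.
Qed.

Lemma bicompl_positive_s_closed I z : archimedean_ovs X ->
  (forall y : Y, 0 <= y -> y != 0 -> exists x : X, 0 < i x /\ i x <= y) ->
  ideal I -> directed I -> s_closed I ->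
  disjoint_compl (disjoint_compl I) z -> 0 <= z -> I z.
Proof.
move=> archX perv [solI subI] dirI sI Iz z0.
have [latY _ _] := coverY.
apply: sI => //; split=> [x [_ /andP[]]//|w ubw].
have I0 := subspace0 subI.
have w0 : 0 <= w by apply: ubw; rewrite /= lexx.
have [s [zws s0 lubs]] := pospart_exists (i (z - w)) latY.
have [s_eq0|s_neq0] := eqVneq s 0.
  by move: zws; rewrite s_eq0 -(raddf0 i) cover_le lev_subLR add0r.
exfalso; have [x [x0 xs]] := perv s s0 s_neq0.
have x_ge0 : 0 <= x by rewrite -cover_ge0 ltW.
have xz : x <= z.
  rewrite -cover_le (le_trans xs)// lubs ?cover_ge0// cover_le.
  by rewrite lev_subLR -[leLHS]addr0 lev_D2l.
(* Without such a [y], the element [x] would lie in [I^d]; it lies in [I^dd] as [x <= z], so it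
   would be disjoint from itself although [0 < i x]. *)
have [y [y0 y_neq0 [yx [a [Ia ya]]]]] : exists y,
    [/\ 0 <= y, y != 0 & y <= i x /\ exists a, I a /\ y <= i a].
  apply: contrapT => noy.
  suff xx : disjoint_compl I x.
    have Ixx := disjoint_compl_solid Iz x_ge0 xz.
    move/disjoint_complP : Ixx => /(_ x xx (i x)).
    by rewrite modulus_id ?cover_ge0// => /(_ (lexx _) (lexx _)); rewrite lt_geF.
  apply/disjoint_complP => a Ia t tx ta.
  have [t' [tt' t'0 lubt]] := pospart_exists t latY.
  have [<-//|t'_neq0] := eqVneq t' 0.
  (* Directedness of [I] replaces [|a|], which may exist only in [Y], by a majorant [b] in [I]. *)
  have INa : I (- a) by rewrite -[- a]add0r; apply: subspaceB.
  have [_ [b [_ Ib _ [ab nab]]]] := dirI _ _ Ia INa.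
  have [_ _ luba] := absP (i a).
  have ib : abs (i a) <= i b by apply: luba; rewrite -?raddfN cover_le.
  case: noy; exists t'; split=> //; split.
    by rewrite lubt ?cover_ge0// -(modulus_id (y := i x)) ?cover_ge0.
  exists b; split=> //; apply: lubt; first exact: le_trans ib.
  exact: le_trans (modulus_ge0 absP _) ib.
have [v [v0 vy]] := perv y y0 y_neq0.
have Iv : I v.
  apply: (solid_itv solI Ia); first by rewrite -cover_ge0 ltW.
  by rewrite -cover_le (le_trans vy).
have v_ge0 : 0 <= v by rewrite -cover_ge0 ltW.
have vs : i v <= s by rewrite (le_trans vy)// (le_trans yx).
have nv n : I (v *+ n) /\ 0 <= v *+ n <= z.
  elim: n => [|n [In /andP[n0 nz]]]; first by rewrite mulr0n lexx z0.
  rewrite mulrSr; split; first exact: subspaceD.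
  apply/andP; split; first by rewrite -[leLHS]addr0 levD.
  have nw : v *+ n <= w by apply: ubw; rewrite /= n0.
  (* As [v *+ n] is below [w] and [z], [z - v *+ n] bounds [z - w] and 0, hence [s], which bounds
     [v]. *)
  rewrite addrC -lev_subRL -cover_le (le_trans vs)// lubs ?cover_ge0 ?subv_ge0//.
  by rewrite cover_le lev_D2l lev_N2.
have := archX v z (fun n => (andP (nv n).2).2).
by rewrite -cover_le raddf0 lt_geF.
Qed.

End Cover.

Theorem corollary17 (R : realType) (X : orderedVectorType R) (I : set X)
    (archX : archimedean_ovs X) (preRieszX : pre_riesz X)
    (idealI : ideal I) (directedI : directed I) :
  (riesz_decomposition X -> o_closed I -> s_closed I) /\
  (pervasive X -> directed (disjoint_compl (disjoint_compl I)) ->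
     s_closed I -> o_closed I).
Proof.
split=> [rdp oI|[Y [i [coverY perv]]] dirII sI]; first exact: o_closed_s_closed.
have [latY _ _] := coverY; have [abs absP] := modulus_exists latY.
move=> A le u x dirA Iu ux.
have IIx : disjoint_compl (disjoint_compl I) x.
  apply: (disjoint_compl_o_closed coverY absP dirA _ ux) => a; exact: sub_bicompl.
have I0 : disjoint_compl (disjoint_compl I) 0.
  exact/sub_bicompl/(subspace0 idealI.2).
(* An upper bound [z] of 0 and [x] in [I^dd] gives [x = z - (z - x)] with both terms positive. *)
have [_ [z [_ IIz _ [z0 xz]]]] := dirII _ _ I0 IIx.
have Ipos := bicompl_positive_s_closed coverY absP archX perv idealI directedI sI.
have Izx : I (z - x).
  apply: Ipos; rewrite ?subv_ge0//.
  exact: (disjoint_compl_sub coverY absP).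
rewrite -(subKr z x); exact: subspaceB idealI.2 (Ipos z IIz z0) Izx.
Qed.
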